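(* Let $R_1$ and $R_2$ be commutative rings with $1 \neq 0$, let $R = R_1 \times R_2$, and let $I$ be a proper ideal of $R$. The following statements are equivalent: (1) $I$ is a weakly semiprimary ideal of $R$. (2) $I = \{(0,0)\}$ or $I$ is a semiprimary ideal of $R$. (3) $I = \{(0,0)\}$, or $I = I_1 \times R_2$ for some semiprimary ideal $I_1$ of $R_1$, or $I = R_1 \times I_2$ for some semiprimary ideal $I_2$ of $R_2$.
   Context: An ideal is proper if it is not the whole ring; $\sqrt{I}$ denotes the radical of $I$. A proper ideal $I$ of a ring $R$ is semiprimary if whenever $a,b \in R$ and $ab \in I$, then $a \in \sqrt{I}$ or $b \in \sqrt{I}$. A proper ideal $I$ of $R$ is weakly semiprimary if whenever $a,b\in R$ and $0 \neq ab \in I$, then $a \in \sqrt{I}$ or $b \in \sqrt{I}$. *)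

(* Defs.v *)
From HB Require Import structures.
From mathcomp Require Import all_boot all_order all_algebra.
From mathcomp Require Import boolp classical_sets.
Set Implicit Arguments.
Unset Strict Implicit.
Unset Printing Implicit Defensive.
Import GRing.Theory.
Local Open Scope ring_scope.
Local Open Scope classical_set_scope.

(* Ideals are classical sets (not just decidable predicates). The library's
   [idealr_closed] contains properness, in the form 1 \notin I; see
   [proper_idealP] below. *)
Definition is_proper_ideal (R : comNzRingType) (I : set R) : Prop :=
  idealr_closed (mem I).

Definition radical (R : comNzRingType) (I : set R) : set R :=
  [set x | exists2 n : nat, (0 < n)%N & I (x ^+ n)].

Definition semiprimary (R : comNzRingType) (I : set R) : Prop :=
  is_proper_ideal I /\
  forall a b : R, I (a * b) -> radical I a \/ radical I b.

Definition weakly_semiprimary (R : comNzRingType) (I : set R) : Prop :=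
  is_proper_ideal I /\
  forall a b : R, 0 <> a * b -> I (a * b) -> radical I a \/ radical I b.

Lemma proper_idealP (R : comNzRingType) (I : set R) :
  is_proper_ideal I <->
  [/\ I 0,
      forall x y, I x -> I y -> I (x + y),
      forall a x, I x -> I (a * x)
    & I <> setT].
Proof.
split=> [[I0 I1 IL]|[I0 ID IM IT]].
  have I0' : I 0 by move: I0; rewrite inE.
  have IL' a x y : I x -> I y -> I (a * x + y).
    by move=> Ix Iy; have := IL a x y; rewrite !inE; apply.
  split=> // [x y Ix Iy|a x Ix|IT].
  - by rewrite -[x]mul1r; apply: IL'.
  - by rewrite -[a * x]addr0; apply: IL'.
  - by move/negP: I1; apply; rewrite inE IT.
split; first by rewrite inE.
  apply/negP; rewrite inE => I1; apply: IT.
  by apply/seteqP; split=> // x _; rewrite -[x]mulr1; apply: IM.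
by move=> a x y; rewrite !inE => Ix Iy; apply: ID => //; apply: IM.
Qed.

(* Main.v *)
Require Import Defs.
From HB Require Import structures.
From mathcomp Require Import all_boot all_order all_algebra.
From mathcomp Require Import boolp classical_sets.
From mathcomp Require Import ring.
Set Implicit Arguments.
Unset Strict Implicit.
Unset Printing Implicit Defensive.
Import GRing.Theory.
Local Open Scope ring_scope.
Local Open Scope classical_set_scope.

(** The point is that a nonzero weakly semiprimary ideal [I] of [R1 * R2]
    contains one of the two idempotents [(1, 0)] and [(0, 1)].  Indeed, if
    [(a, b)] is a nonzero element of [I], then
    [(a, b) = (a, 1) * (1, b)] puts a power of [(a, 1)] or of [(1, b)] in [I],
    and multiplying that power by [(0, 1)] or [(1, 0)] leaves the idempotent
    ([weakly_semiprimary_prod_idem]).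

    Once a nonzero idempotent [e] lies in [I], the restriction to nonzero
    products is harmless: modulo [I] every factor may be changed so that its
    [e]-component is [e], which makes the product nonzero without affecting
    membership in the radical ([weakly_semiprimary_idem]).  So [I] is
    semiprimary.

    Finally [(0, 1)] generates the kernel of the first projection, and [(1, 0)]
    that of the second one, so [I] is the preimage of its image under a
    projection ([preimage_image_ideal]), and being semiprimary passes through
    preimages by surjective morphisms in both directions
    ([semiprimary_preimage]).  Treating the two projections as instances of a
    surjective morphism makes the two factors play symmetric roles. *)

Lemma semiprimary_weakly (R : comNzRingType) (I : set R) :
  semiprimary I -> weakly_semiprimary I.
Proof. by move=> [pI sI]; split=> // a b _; apply: sI. Qed.

Section Ideals.
Variables (R : comNzRingType) (I : set R).
Hypothesis hI : is_proper_ideal I.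

Lemma ideal_addr x y : I x -> I y -> I (x + y).
Proof. by have /proper_idealP[_ + _ _] := hI; apply. Qed.

Lemma ideal_mull a x : I x -> I (a * x).
Proof. by have /proper_idealP[_ _ + _] := hI; apply. Qed.

Lemma radical_congr a b : I (a - b) -> radical I a -> radical I b.
Proof.
move=> Iab [n n0 Ian]; exists n => //.
have -> : b ^+ n = a ^+ n + - (\sum_(i < n) a ^+ (n.-1 - i) * b ^+ i) * (a - b).
  by rewrite mulNr mulrC -subrXX subKr.
by apply: ideal_addr => //; apply: ideal_mull.
Qed.

(** Replacing [x] by [x + e * (1 - x) = (1 - e) * x + e] changes neither its
    class modulo [I] nor its membership in the radical, while a product of two
    such elements has [e]-component [e <> 0] and is therefore nonzero. *)
Lemma weakly_semiprimary_idem e : e * e = e -> e <> 0 -> I e ->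
  weakly_semiprimary I -> semiprimary I.
Proof.
move=> ee e0 Ie [_ wI]; split=> // a b Iab.
pose s x : R := x + e * (1 - x).
have es x : e * s x = e by rewrite /s mulrDr mulrA ee -mulrDr subrKC mulr1.
have rad_s x : radical I (s x) -> radical I x.
  by apply: radical_congr; rewrite /s addrC addKr mulrC; apply: ideal_mull.
have sab : s a * s b = a * b + (b * (1 - a) + s a * (1 - b)) * e. by rewrite /s; ring.
have sab0 : 0 <> s a * s b.
  by move=> sab_eq0; apply: e0; rewrite -(es b) -{1}(es a) -mulrA -sab_eq0 mulr0.
have Isab : I (s a * s b) by rewrite sab; apply: ideal_addr => //; apply: ideal_mull.
by have [/rad_s|/rad_s] := wI _ _ sab0 Isab; [left|right].
Qed.

End Ideals.

Section Preimage.
Variables (R S : comNzRingType) (f : {rmorphism R -> S}).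

Lemma preimage_image_ideal (I : set R) : is_proper_ideal I ->
  (forall x, f x = 0 -> I x) -> I = f @^-1` (f @` I).
Proof.
move=> hI kerI; apply/seteqP; split=> [x Ix|x [y Iy fyx]]; first by exists x.
rewrite -[x](subrK y); apply: ideal_addr => //.
by apply: kerI; rewrite rmorphB fyx subrr.
Qed.

Hypothesis f_surj : forall y, exists x, f x = y.

Lemma proper_ideal_preimage (J : set S) :
  is_proper_ideal (f @^-1` J) <-> is_proper_ideal J.
Proof.
rewrite !proper_idealP; split=> -[J0 JD JM JT]; split.
- by rewrite -(rmorph0 f).
- move=> y z; have [x <-] := f_surj y; have [t <-] := f_surj z.
  by rewrite -rmorphD; apply: JD.
- move=> a y; have [x <-] := f_surj y; have [t <-] := f_surj a.
  by rewrite -rmorphM; apply: JM.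
- by move=> JE; apply: JT; rewrite JE preimage_setT.
- by rewrite /preimage /= rmorph0.
- by move=> x y; rewrite /preimage /= rmorphD; apply: JD.
- by move=> a x; rewrite /preimage /= rmorphM; apply: JM.
- move=> JE; apply: JT; apply/seteqP; split=> // y _.
  by have [x <-] := f_surj y; suff : (f @^-1` J) x by []; rewrite JE.
Qed.

Lemma radical_preimage (J : set S) x :
  radical (f @^-1` J) x <-> radical J (f x).
Proof.
by split=> -[n n0 Jx]; exists n => //; move: Jx; rewrite /preimage /= rmorphXn.
Qed.

Lemma semiprimary_preimage (J : set S) :
  semiprimary (f @^-1` J) <-> semiprimary J.
Proof.
split=> -[/proper_ideal_preimage hJ sJ]; split=> // a b.
  have [x <-] := f_surj a; have [y <-] := f_surj b.
  by rewrite -rmorphM -!radical_preimage; apply: sJ.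
by rewrite /preimage /= rmorphM !radical_preimage; apply: sJ.
Qed.

(** The kernel condition makes [f @` I] an ideal with preimage [I]. *)
Lemma semiprimary_image (I : set R) : (forall x, f x = 0 -> I x) ->
  semiprimary I -> semiprimary (f @` I) /\ I = f @^-1` (f @` I).
Proof.
move=> kerI sI; have IE := preimage_image_ideal (proj1 sI) kerI.
by split=> //; apply/semiprimary_preimage; rewrite -IE.
Qed.

End Preimage.

Section Product.
Variables R1 R2 : comNzRingType.
Implicit Type I : set (R1 * R2)%type.

Lemma pairX (a : R1) (b : R2) n : (a, b) ^+ n = (a ^+ n, b ^+ n).
Proof. by elim: n => [|n IHn]; rewrite ?expr0 // !exprS IHn. Qed.

Lemma pairM (a c : R1) (b d : R2) : (a, b) * (c, d) = (a * c, b * d).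
Proof. by []. Qed.

(** A nonzero element [(a, b)] of [I] is the product of [(a, 1)] and [(1, b)];
    whichever factor lies in the radical, its powers keep a component [1], which
    a multiplication by the matching idempotent isolates. *)
Lemma weakly_semiprimary_prod_idem I : weakly_semiprimary I ->
  I <> [set (0, 0)] -> I (0, 1) \/ I (1, 0).
Proof.
move=> [hI wI] I0.
have [[a b] Iab ab0] : exists2 x, I x & 0 <> x.
  apply: contrapT => noI; apply: I0; apply/seteqP; split=> [x Ix|x ->].
    by apply: contrapT => x0; apply: noI; exists x => // /esym.
  by have /proper_idealP[] := hI.
have abE : (a, b) = (a, 1) * (1, b) by rewrite pairM mulr1 mul1r.
rewrite abE in Iab ab0.
have [[n n0]|[n n0]] := wI _ _ ab0 Iab; rewrite pairX expr1n => In; [left|right].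
  by have := ideal_mull hI (0, 1) In; rewrite pairM mul0r mulr1.
by have := ideal_mull hI (1, 0) In; rewrite pairM mul0r mulr1.
Qed.

Lemma fst_surj (y : R1) : exists x : R1 * R2, x.1 = y.
Proof. by exists (y, 0). Qed.

Lemma snd_surj (y : R2) : exists x : R1 * R2, x.2 = y.
Proof. by exists (0, y). Qed.

Lemma preimage_fst (J : set R1) : fst @^-1` J = J `*` [set: R2].
Proof. by apply/seteqP; split=> [x Jx|x []]. Qed.

Lemma preimage_snd (J : set R2) : snd @^-1` J = [set: R1] `*` J.
Proof. by apply/seteqP; split=> [x Jx|x []]. Qed.

Lemma ker_fst_sub I : is_proper_ideal I -> I (0, 1) ->
  forall x, x.1 = 0 -> I x.
Proof.
move=> hI I01 [a b] /= ->.
by have := ideal_mull hI (0, b) I01; rewrite pairM mul0r mulr1.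
Qed.

Lemma ker_snd_sub I : is_proper_ideal I -> I (1, 0) ->
  forall x, x.2 = 0 -> I x.
Proof.
move=> hI I10 [a b] /= ->.
by have := ideal_mull hI (a, 0) I10; rewrite pairM mul0r mulr1.
Qed.

Lemma weakly_semiprimary_prod I : weakly_semiprimary I ->
  [\/ I = [set (0, 0)],
      exists2 I1 : set R1, semiprimary I1 & I = I1 `*` [set: R2]
    | exists2 I2 : set R2, semiprimary I2 & I = [set: R1] `*` I2].
Proof.
move=> wI; have hI := proj1 wI.
have [->|I0] := EM (I = [set (0, 0)]); first by constructor 1.
have [I01|I10] := weakly_semiprimary_prod_idem wI I0.
- constructor 2.
  have sI : semiprimary I.
    apply: (weakly_semiprimary_idem hI _ _ I01 wI).
      by rewrite pairM mul0r mulr1.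
    by move=> [] /eqP; rewrite oner_eq0.
  have [sI1 IE] := semiprimary_image (f := fst) fst_surj (ker_fst_sub hI I01) sI.
  by exists (fst @` I) => //; rewrite -preimage_fst.
- constructor 3.
  have sI : semiprimary I.
    apply: (weakly_semiprimary_idem hI _ _ I10 wI).
      by rewrite pairM mul0r mulr1.
    by move=> [] /eqP; rewrite oner_eq0.
  have [sI2 IE] := semiprimary_image (f := snd) snd_surj (ker_snd_sub hI I10) sI.
  by exists (snd @` I) => //; rewrite -preimage_snd.
Qed.

End Product.

Theorem corollary4p3 (R1 R2 : comNzRingType) (I : set (R1 * R2)%type)
    (hI : is_proper_ideal I) :
  (weakly_semiprimary I <-> (I = [set (0, 0)] \/ semiprimary I)) /\
  ((I = [set (0, 0)] \/ semiprimary I) <->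
   [\/ I = [set (0, 0)],
       exists2 I1 : set R1, semiprimary I1 & I = I1 `*` [set: R2]
     | exists2 I2 : set R2, semiprimary I2 & I = [set: R1] `*` I2]).
Proof.
have zero_or_sp_weakly : I = [set (0, 0)] \/ semiprimary I -> weakly_semiprimary I.
  case=> [IE|]; last exact: semiprimary_weakly.
  split=> // a b ab0.
  by rewrite IE => /esym /ab0.
have factor_zero_or_sp :
    [\/ I = [set (0, 0)],
        exists2 I1 : set R1, semiprimary I1 & I = I1 `*` [set: R2]
      | exists2 I2 : set R2, semiprimary I2 & I = [set: R1] `*` I2] ->
    I = [set (0, 0)] \/ semiprimary I.
  case=> [->|[J sJ ->]|[J sJ ->]]; [by left|right..].
    by rewrite -preimage_fst; exact/(semiprimary_preimage (f := fst) (@fst_surj R1 R2)).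
  by rewrite -preimage_snd; exact/(semiprimary_preimage (f := snd) (@snd_surj R1 R2)).
split; split=> //.
  by move/weakly_semiprimary_prod/factor_zero_or_sp.
by move/zero_or_sp_weakly/weakly_semiprimary_prod.
Qed.
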